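(* For every $A>0$ there exist constants $c>0$ and $C>0$, depending only on $A$ (not on $n,p,\mathbf X,\beta_{\rm true},\epsilon$ or the tuning parameters), such that the following holds. Suppose $\|\mathrm f_{S_0}-\mathbf f^0\|_2^2/n\le A\,\lambda_{\rm init}^2 s_0/\phi^2(6,S_0)$, suppose $$\frac{\lambda_{\rm init}}{\phi^2(6,S_0,2s_0)}\le c\,\lambda_{\rm thres},$$ and suppose $\epsilon\in\mathcal T$. Then $$\|\mathbf X\hat b_{\rm thres}-\mathbf f^0\|_2^2/n\le C\,\Lambda_{\rm sparse}^2(s_0)\,\frac{\lambda_{\rm thres}^2}{\lambda_{\rm init}^2}\,\lambda_{\rm init}^2 s_0,$$ $$\|\hat b_{\rm thres}-b^0\|_1\le C\,\frac{\Lambda_{\rm sparse}(s_0)}{\phi_{\rm sparse}(S_0,2s_0)}\,\frac{\lambda_{\rm thres}}{\lambda_{\rm init}}\,\lambda_{\rm init}s_0,$$ $$\|\hat b_{\rm thres}-b^0\|_2\le C\,\frac{\Lambda_{\rm sparse}(s_0)}{\phi_{\rm sparse}(S_0,2s_0)}\,\frac{\lambda_{\rm thres}}{\lambda_{\rm init}}\,\lambda_{\rm init}\sqrt{s_0},$$ $$|\hat S_{\rm thres}\setminus S_0|\le C\,\frac{1}{\phi^4(6,S_0,2s_0)}\,\frac{\lambda_{\rm init}^2}{\lambda_{\rm thres}^2}\,s_0.$$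
   Context: Setting. $n,p\in\mathbb N$ with $p\ge n$; $\mathbf X\in\mathbb R^{n\times p}$ is a fixed matrix with columns $\mathbf X_1,\dots,\mathbf X_p$; $\hat\Sigma:=\mathbf X^T\mathbf X/n$ is normalized so that $\hat\Sigma_{j,j}=1$ for all $j$. $\beta_{\rm true}\in\mathbb R^p$, $\mathbf f^0:=\mathbf X\beta_{\rm true}$, $S_{\rm true}:=\{j:\beta_{j,{\rm true}}\ne0\}$, $\epsilon\in\mathbb R^n$ is the noise, $\mathbf Y=\mathbf f^0+\epsilon$. For $\beta\in\mathbb R^p$ and $S\subset\{1,\dots,p\}$, $\beta_S$ is the vector with $(\beta_S)_j=\beta_j 1\{j\in S\}$, and $S^c$ is the complement. Generalized eigenvalues. $\Lambda_{\max}^2(S):=\max_{\|\beta_S\|_2=1}\beta_S^T\hat\Sigma\beta_S$, $\Lambda_{\min}^2(S):=\min_{\|\beta_S\|_2=1}\beta_S^T\hat\Sigma\beta_S$. For $\mathcal N\supset S$ and $L>0$, $$\mathcal R(L,S,\mathcal N):=\{\beta:\ \|\beta_{\mathcal N^c}\|_1\le L\sqrt{|\mathcal N|}\,\|\beta_{\mathcal N}\|_2,\ \max_{j\in\mathcal N^c}|\beta_j|\le\min_{j\in\mathcal N\setminus S}|\beta_j|\}$$ (a minimum over the empty set is $+\infty$). For $N\ge|S|$, $\phi^2(L,S,N):=\min\{\beta^T\hat\Sigma\beta/\|\beta_{\mathcal N}\|_2^2:\ \mathcal N\supset S,\ |\mathcal N|\le N,\ \beta\in\mathcal R(L,S,\mathcal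 N),\ \beta_{\mathcal N}\neq0\}$, and $\phi(L,S):=\phi(L,S,|S|)$. Sparse eigenvalues: $\Lambda_{\rm sparse}(N):=\max_{|\mathcal N|=N}\Lambda_{\max}(\mathcal N)$, $\phi_{\rm sparse}(S,N):=\min_{\mathcal N\supset S,\,|\mathcal N|=N}\Lambda_{\min}(\mathcal N)$ for $|S|\le N$. The quantities appearing are assumed well defined (in particular $s_0\ge1$, $2s_0\le p$), and those in denominators positive. Oracle. $\mathrm f_S=\mathbf X b^S:=\arg\min_{f=\mathbf X\beta_S}\|f-\mathbf f^0\|_2$ ($b^S$ supported on $S$). $S_0$ is a minimizer over $S\subset S_{\rm true}$ of $\|\mathrm f_S-\mathbf f^0\|_2^2/n+7\lambda_{\rm init}^2|S|/\phi^2(6,S)$ (second term $0$ for $S=\emptyset$, $+\infty$ if $S\neq\emptyset$ and $\phi(6,S)=0$). $b^0:=b^{S_0}$, $s_0:=|S_0|$. Noise event. $\mathcal T:=\{4\max_{1\le j\le p}|\epsilon^T\mathbf X_j/n|\le\lambda_{\rm init}\}$; ''$\epsilon\in\mathcal T$'' means this inequality holds. Estimators. $\lambda_{\rm init},\lambda_{\rm thres}>0$. $\hat\beta_{\rm init}\in\arg\min_\beta\{\|\mathbf Y-\mathbf X\beta\|_2^2/n+\lambda_{\rm init}\|\beta\|_1\}$; $\hat S_{\rm thres}:=\{j:|\hat\beta_{j,{\rm init}}|>\lambda_{\rm thres}\}$; $\hat b_{\rm thres}$ is the least squares refit: it minimizes $\|\mathbf Y-\mathbf X\beta\|_2^2/n$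 over $\beta$ supported on $\hat S_{\rm thres}$. *)

(* Defs.v *)
From HB Require Import structures.
From mathcomp Require Import all_boot all_order all_algebra.
From mathcomp Require Import boolp classical_sets reals constructive_ereal ereal.

Set Implicit Arguments.
Unset Strict Implicit.
Unset Printing Implicit Defensive.

Import Order.TTheory GRing.Theory Num.Theory.
Local Open Scope ring_scope.

(* Vectors are column vectors.  The norm that MathComp-Analysis puts on
   matrices is the max norm, hence the explicit l1 and l2 norms. *)
Section Norms.
Variables (R : realType) (p : nat).
Implicit Types (beta : 'cV[R]_p) (S : {set 'I_p}).

Definition l1norm beta : R := \sum_(j < p) `|beta j 0|.
Definition l2norm beta : R := Num.sqrt (\sum_(j < p) beta j 0 ^+ 2).

Definition restr S beta : 'cV[R]_p :=
  \col_(j < p) (beta j 0 * (j \in S)%:R).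

Definition supported S beta : Prop := restr S beta = beta.

Definition support_set beta : {set 'I_p} := [set j | beta j 0 != 0]%SET.
End Norms.

(* Maxima and minima of real-valued quantities are written as sup and inf.
   By compactness (after scaling to |beta_N|_2 = 1 in the case of phi2) or by
   finiteness they are attained as soon as the set of values is nonempty; on
   an empty set the library's sup and inf take the value 0. *)
Section Eigenvalues.
Variables (R : realType) (n p : nat) (X : 'M[R]_(n, p)).
Implicit Types (beta : 'cV[R]_p) (S NN : {set 'I_p}) (L : R) (N : nat).

Definition Sigma_hat : 'M[R]_p := n%:R^-1 *: (X^T *m X).

Definition quad beta : R := (beta^T *m Sigma_hat *m beta) 0 0.

Definition Lambda_max S : R :=
  Num.sqrt (sup (fun x : R => exists beta,
    l2norm (restr S beta) = 1 /\ x = quad (restr S beta))).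

Definition Lambda_min S : R :=
  Num.sqrt (inf (fun x : R => exists beta,
    l2norm (restr S beta) = 1 /\ x = quad (restr S beta))).

(* The set R(L, S, N).  Extended reals make the minimum over an empty set
   +oo (and the maximum over an empty set -oo). *)
Definition restricted_set L S NN beta : Prop :=
  l1norm (restr (~: NN) beta)
    <= L * Num.sqrt #|NN|%:R * l2norm (restr NN beta) /\
  (\big[Order.max/-oo]_(j in ~: NN) (`|beta j 0|)%:E
    <= \big[Order.min/+oo]_(j in NN :\: S) (`|beta j 0|)%:E)%E.

Definition phi2 L S N : R :=
  inf (fun x : R => exists NN : {set 'I_p}, exists beta,
    [/\ S \subset NN, (#|NN| <= N)%N, restricted_set L S NN beta,
        restr NN beta != 0
      & x = quad beta / l2norm (restr NN beta) ^+ 2]).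

Definition phi L S N : R := Num.sqrt (phi2 L S N).

Definition phi_card L S : R := phi L S #|S|.

Definition Lambda_sparse N : R :=
  sup (fun x : R => exists NN : {set 'I_p},
    #|NN| = N /\ x = Lambda_max NN).

Definition phi_sparse S N : R :=
  inf (fun x : R => exists NN : {set 'I_p},
    [/\ S \subset NN, #|NN| = N & x = Lambda_min NN]).
End Eigenvalues.

Section Estimation.
Variables (R : realType) (n p : nat) (X : 'M[R]_(n, p)).
Implicit Types (Y eps : 'cV[R]_n) (beta : 'cV[R]_p) (S : {set 'I_p}).

(* beta is a least squares fit of Y among vectors supported on S.  It gives
   both b^S (for Y = f0) and the refit after thresholding. *)
Definition least_squares_on Y S beta : Prop :=
  supported S beta /\
  forall beta', supported S beta' ->
    l2norm (Y - X *m beta) ^+ 2 / n%:R <= l2norm (Y - X *m beta') ^+ 2 / n%:R.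

Definition lasso_objective Y (lambda : R) beta : R :=
  l2norm (Y - X *m beta) ^+ 2 / n%:R + lambda * l1norm beta.

Definition is_lasso Y (lambda : R) beta : Prop :=
  forall beta', lasso_objective Y lambda beta <= lasso_objective Y lambda beta'.

Definition threshold_set (lambda : R) beta : {set 'I_p} :=
  [set j | lambda < `|beta j 0|]%SET.

Definition oracle_penalty (lambda : R) S : \bar R :=
  if S == finset.set0 then 0%E
  else if phi_card X 6 S == 0 then +oo%E
  else (7 * lambda ^+ 2 * #|S|%:R / phi_card X 6 S ^+ 2)%:E.

Definition oracle_objective (f0 : 'cV[R]_n) (b : {set 'I_p} -> 'cV[R]_p)
    (lambda : R) S : \bar R :=
  ((l2norm (X *m b S - f0) ^+ 2 / n%:R)%:E + oracle_penalty lambda S)%E.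

(* b S is the coefficient vector b^S of the projection f_S. *)
Definition is_oracle_set (f0 : 'cV[R]_n) (b : {set 'I_p} -> 'cV[R]_p)
    (lambda : R) (S_true S0 : {set 'I_p}) : Prop :=
  S0 \subset S_true /\
  forall S, S \subset S_true ->
    (oracle_objective f0 b lambda S0 <= oracle_objective f0 b lambda S)%E.

Definition noise_event (lambda : R) eps : Prop :=
  4 * \big[Num.max/0]_(j < p) `|(eps^T *m col j X) 0 0 / n%:R| <= lambda.
End Estimation.

(* Main.v *)
(* Write S for S_0, d for beta_init - b^0, phi for phi(6, S, 2 s_0) and m for
   lambda_init / phi^2.  On the noise event the basic inequality of the Lasso
   bounds |X d|^2/n by a multiple of m^2 phi^2 s_0 and |d|_1 by a multiple of
   m s_0: either the approximation error dominates, or d lies in the cone on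
   which phi(6, S) controls it.  Completing S by the s_0 largest coordinates
   of d outside S upgrades this to |d|_2^2 <= K m^2 s_0.  With m <= lambda_thres
   / K the thresholded set has at most s_0 elements outside S, and the
   restriction v of b^0 to it differs from b^0 by O(lambda_thres sqrt s_0) in
   l2 norm.  Comparing the refit with v gives the prediction bound, since
   their difference, being supported on a set of at most 2 s_0 elements
   containing S, is in the restricted set; the phi that remains is absorbed
   by phi <= 1 <= Lambda_sparse, which holds because the columns are
   normalized.  The norm bounds follow from phi_sparse. *)

Require Import Defs.
From mathcomp Require Import all_boot all_order all_algebra.
From mathcomp Require Import boolp classical_sets reals constructive_ereal ereal.
From mathcomp Require Import ring lra.

Set Implicit Arguments.
Unset Strict Implicit.
Unset Printing Implicit Defensive.

Import Order.TTheory GRing.Theory Num.Theory.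
Local Open Scope ring_scope.

(** * Cardinalities and elementary inequalities for finite sums *)

Lemma cardsU_setD (I : finType) (S T : {set I}) :
  #|S :|: T| = (#|S| + #|T :\: S|)%N.
Proof.
rewrite -(cardsID S (S :|: T)) finset.setDUl finset.setDv finset.set0U.
congr (_ + _)%N; apply: eq_card => j; rewrite !inE.
by case: (j \in S); rewrite ?andbF.
Qed.

(** Cauchy-Schwarz without square roots: the squares of [sb * a i - c * b i] sum to
    [sb * (sa * sb - c ^+ 2)]. If [sb] vanishes, so does every [b i], hence also [c]. *)
Lemma sqr_sum_mul_le (R : realFieldType) (I : finType) (P : pred I)
    (a b : I -> R) :
  (\sum_(i | P i) a i * b i) ^+ 2
    <= (\sum_(i | P i) a i ^+ 2) * (\sum_(i | P i) b i ^+ 2).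
Proof.
set sa := \sum_(i | P i) a i ^+ 2; set sb := \sum_(i | P i) b i ^+ 2.
set c := \sum_(i | P i) a i * b i.
have sb_ge0 : 0 <= sb by apply: sumr_ge0 => i _; rewrite sqr_ge0.
have : 0 <= \sum_(i | P i) (sb * a i - c * b i) ^+ 2.
  by apply: sumr_ge0 => i _; rewrite sqr_ge0.
have -> : \sum_(i | P i) (sb * a i - c * b i) ^+ 2 = sb * (sa * sb - c ^+ 2).
  rewrite (eq_bigr (fun i => sb ^+ 2 * a i ^+ 2 + c ^+ 2 * b i ^+ 2
    - 2 * (sb * c) * (a i * b i))); last by move=> i _; ring.
  rewrite sumrB big_split /= -!mulr_sumr -/sa -/sb -/c; ring.
have [sb_gt0|] := ltP 0 sb; first by rewrite pmulr_rge0// subr_ge0.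
move=> sb_le0 _; have sb0 : sb = 0 by apply/eqP; rewrite eq_le sb_le0.
suff -> : c = 0 by rewrite sb0 mulr0 expr0n.
apply: big1 => i Pi; apply/eqP; rewrite mulf_eq0 -[b i == 0]sqrf_eq0.
have/eqP := sb0; rewrite psumr_eq0 => [/allP /(_ i)|j _]; last exact: sqr_ge0.
by rewrite mem_index_enum Pi /= => ->//; rewrite orbT.
Qed.

Lemma sqr_sumr_le (R : realFieldType) (I : finType) (A : {set I}) (a : I -> R) :
  (\sum_(i in A) a i) ^+ 2 <= #|A|%:R * \sum_(i in A) a i ^+ 2.
Proof.
have := sqr_sum_mul_le (mem A) (fun=> 1) a.
under eq_bigr do rewrite mul1r.
by under [X in X * _]eq_bigr do rewrite expr1n; rewrite sumr_const.
Qed.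

Lemma sqrD_le (R : realFieldType) (x y : R) :
  (x + y) ^+ 2 <= 2 * x ^+ 2 + 2 * y ^+ 2.
Proof. by have := sqr_ge0 (x - y); nra. Qed.

(* Absorbs the linear term of a basic inequality into its quadratic term. *)
Lemma le_add_of_sqr_le_mul (R : realFieldType) (x y z : R) :
  0 <= y -> 0 <= z -> x ^+ 2 <= 4 * (y * z) -> x <= y + z.
Proof.
move=> y0 z0 h; have [x0|x0] := leP x 0.
  by rewrite (le_trans x0) ?addr_ge0.
rewrite -ler_sqr ?nnegrE ?addr_ge0 ?(ltW x0)//.
by apply: le_trans h _; have := sqr_ge0 (y - z); nra.
Qed.

(** * Norms, restrictions and supports of vectors *)

Section Norms.
Variables (R : realType) (p : nat).
Implicit Types (u v : 'cV[R]_p) (S T : {set 'I_p}).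

Lemma l2norm_sqr v : l2norm v ^+ 2 = \sum_j v j 0 ^+ 2.
Proof. by rewrite sqr_sqrtr// sumr_ge0// => j _; rewrite sqr_ge0. Qed.

Lemma l2norm_ge0 v : 0 <= l2norm v. Proof. exact: sqrtr_ge0. Qed.

Lemma l1norm_ge0 v : 0 <= l1norm v. Proof. exact: sumr_ge0. Qed.

Lemma l2norm_eq0 v : (l2norm v == 0) = (v == 0).
Proof.
rewrite -sqrf_eq0 l2norm_sqr psumr_eq0; last by move=> j _; rewrite sqr_ge0.
apply/allP/eqP => [h|-> j _]; last by rewrite mxE expr0n eqxx.
apply/colP => j; rewrite mxE; apply/eqP; rewrite -sqrf_eq0.
exact: h (mem_index_enum j).
Qed.

Lemma l2norm_sqrN v : l2norm (- v) ^+ 2 = l2norm v ^+ 2.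
Proof. by rewrite !l2norm_sqr; apply: eq_bigr => j _; rewrite mxE sqrrN. Qed.

Lemma l2norm_sqrD v u :
  l2norm (v + u) ^+ 2 <= 2 * l2norm v ^+ 2 + 2 * l2norm u ^+ 2.
Proof.
rewrite !l2norm_sqr !mulr_sumr -big_split; apply: ler_sum => j _.
by rewrite mxE sqrD_le.
Qed.

Lemma l2norm_sqrZ (a : R) v : l2norm (a *: v) ^+ 2 = a ^+ 2 * l2norm v ^+ 2.
Proof.
by rewrite !l2norm_sqr mulr_sumr; apply: eq_bigr => j _; rewrite mxE exprMn.
Qed.

Lemma l2normZ (a : R) v : 0 <= a -> l2norm (a *: v) = a * l2norm v.
Proof.
move=> a0; apply/eqP.
rewrite -(eqrXn2 (n := 2))// ?l2norm_ge0 ?mulr_ge0 ?l2norm_ge0//.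
by rewrite l2norm_sqrZ exprMn.
Qed.

Lemma l1norm_restr S v : l1norm (restr S v) = \sum_(j in S) `|v j 0|.
Proof.
rewrite [RHS]big_mkcond; apply: eq_bigr => j _; rewrite mxE.
by case: ifP => _; rewrite ?mulr1 // mulr0 normr0.
Qed.

Lemma l2norm_restr_sqr S v : l2norm (restr S v) ^+ 2 = \sum_(j in S) v j 0 ^+ 2.
Proof.
rewrite l2norm_sqr [RHS]big_mkcond; apply: eq_bigr => j _; rewrite mxE.
by case: ifP => _; rewrite ?mulr1 // mulr0 expr0n.
Qed.

Lemma l1norm_split S v :
  l1norm v = l1norm (restr S v) + l1norm (restr (~: S)%SET v).
Proof.
rewrite !l1norm_restr /l1norm (bigID (mem S))/=; congr (_ + _).
by apply: eq_bigl => j; rewrite inE.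
Qed.

Lemma l2norm_sqr_split S v :
  l2norm v ^+ 2 = l2norm (restr S v) ^+ 2 + l2norm (restr (~: S)%SET v) ^+ 2.
Proof.
rewrite !l2norm_restr_sqr l2norm_sqr (bigID (mem S))/=; congr (_ + _).
by apply: eq_bigl => j; rewrite inE.
Qed.

Lemma l1norm_restr_sqr_le S v :
  l1norm (restr S v) ^+ 2 <= #|S|%:R * l2norm (restr S v) ^+ 2.
Proof.
rewrite l1norm_restr l2norm_restr_sqr; apply: le_trans (sqr_sumr_le _ _) _.
by under eq_bigr do rewrite real_normK ?num_real//.
Qed.

Lemma supportedP S v : supported S v <-> forall j, j \notin S -> v j 0 = 0.
Proof.
split=> [h j /negbTE jS|h]; first by rewrite -h mxE jS mulr0.
apply/colP => j; rewrite mxE; case: (boolP (j \in S)) => [_|/h ->].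
  by rewrite mulr1.
by rewrite mul0r.
Qed.

Lemma supported_restr S v : supported S (restr S v).
Proof. by apply/supportedP => j /negbTE jS; rewrite mxE jS mulr0. Qed.

Lemma supported_sub S T v : S \subset T -> supported S v -> supported T v.
Proof.
move=> /fintype.subsetP ST /supportedP h; apply/supportedP => j jT; apply: h.
by apply: contra jT => /ST.
Qed.

Lemma supportedB S v u :
  supported S v -> supported S u -> supported S (v - u).
Proof.
move=> /supportedP hv /supportedP hu; apply/supportedP => j jS.
by rewrite !mxE hv// hu// subr0.
Qed.

Lemma supportedZ S (a : R) v : supported S v -> supported S (a *: v).
Proof.
by move=> /supportedP hv; apply/supportedP => j jS; rewrite mxE hv// mulr0.
Qed.

Lemma l1norm_sqr_le S v : supported S v ->
  l1norm v ^+ 2 <= #|S|%:R * l2norm v ^+ 2.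
Proof. by move=> sv; have := l1norm_restr_sqr_le S v; rewrite sv. Qed.

Lemma supported_restrC S v : supported S v -> restr (~: S)%SET v = 0.
Proof.
move=> /supportedP h; apply/colP => j; rewrite !mxE inE.
by case: (boolP (j \in S)) => [_|/h ->]; rewrite ?mulr0 ?mul0r.
Qed.

Lemma l1norm0 : l1norm (0 : 'cV[R]_p) = 0.
Proof. by apply: big1 => j _; rewrite mxE normr0. Qed.

(* Each coordinate outside 'T' is dominated by 'm' coordinates in 'T :\: S', so
   it is at most the l1 norm outside 'S' divided by 'm'. *)
Lemma l2norm_sqr_tail S T v (m : nat) : S \subset T -> (m <= #|T :\: S|)%N ->
  (forall j k, j \notin T -> k \in T :\: S -> `|v j 0| <= `|v k 0|) ->
  m%:R * l2norm (restr (~: T)%SET v) ^+ 2 <= l1norm (restr (~: S)%SET v) ^+ 2.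
Proof.
move=> /fintype.subsetP ST mT h; set D := l1norm _.
have D0 : 0 <= D by exact: l1norm_ge0.
have sub_sum (A : {set 'I_p}) : (forall j, j \in A -> j \notin S) ->
    \sum_(j in A) `|v j 0| <= D.
  move=> AS; rewrite /D l1norm_restr [leRHS](bigID (mem A))/=.
  rewrite [X in _ <= X + _](_ : _ = \sum_(j in A) `|v j 0|).
    by rewrite lerDl sumr_ge0.
  apply: eq_bigl => j; rewrite inE; case: (boolP (j \in A)) => [/AS ->|] //.
  by rewrite andbF.
have small j : j \notin T -> m%:R * `|v j 0| <= D.
  move=> jT; apply: le_trans (sub_sum (T :\: S) _); last first.
    by move=> k; rewrite inE => /andP[].
  apply: (@le_trans _ _ (\sum_(k in T :\: S) `|v j 0|)).
    by rewrite sumr_const mulrC -[leRHS]mulr_natr ler_wpM2l// ler_nat.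
  by apply: ler_sum => k; exact: h.
rewrite l2norm_restr_sqr mulr_sumr.
apply: (@le_trans _ _ (\sum_(j in ~: T) D * `|v j 0|)).
  apply: ler_sum => j; rewrite inE => jT.
  by rewrite -[v j 0 ^+ 2]real_normK ?num_real// expr2 mulrA ler_wpM2r// small.
rewrite -mulr_sumr expr2 ler_wpM2l//; apply: sub_sum => j.
by rewrite inE; apply: contra => /ST.
Qed.

(** Induction on [m]: each step adds to [T] a coordinate of largest modulus among those still
    outside. *)
Lemma dominating_superset S v (m : nat) : (#|S| + m <= p)%N ->
  exists T, [/\ S \subset T, #|T| = (#|S| + m)%N
    & forall j k, j \notin T -> k \in T :\: S -> `|v j 0| <= `|v k 0|].
Proof.
elim: m => [|m IH] Sm.
  by exists S; rewrite addn0; split => // j k _; rewrite finset.setDv inE.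
have [|T [ST cT domT]] := IH; first by rewrite (leq_trans _ Sm)// addnS.
have /card_gt0P[j0] : (0 < #|~: T|)%N.
  by rewrite cardsCs finset.setCK card_ord subn_gt0 cT -addnS.
rewrite inE => j0T.
have [k kT kmax] := @Order.TotalTheory.arg_maxP _ R _ j0 (fun j => j \notin T)
  (fun j => `|v j 0|) j0T.
exists (k |: T)%SET; split.
- by rewrite (fintype.subset_trans ST)// finset.subsetUr.
- by rewrite cardsU1 kT cT addnS.
move=> j i; rewrite !inE negb_or => /andP[jk jT] /andP[iS /orP[/eqP ->|iT]].
  exact: kmax.
by apply: domT; rewrite // inE iS.
Qed.

End Norms.

(** * The quadratic form and its restricted and sparse eigenvalues *)

Section Quad.
Variables (R : realType) (n p : nat) (X : 'M[R]_(n, p)).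
Implicit Types (v : 'cV[R]_p) (S T : {set 'I_p}) (N : nat) (L : R).

Lemma quadE v : quad X v = l2norm (X *m v) ^+ 2 / n%:R.
Proof.
rewrite /quad /Sigma_hat -scalemxAr -scalemxAl mxE mulrC; congr (_ / _).
rewrite mulmxA -trmx_mul -mulmxA mxE l2norm_sqr.
by apply: eq_bigr => i _; rewrite mxE expr2.
Qed.

Lemma quad_ge0 v : 0 <= quad X v.
Proof. by rewrite quadE divr_ge0// ?sqr_ge0 ?ler0n. Qed.

Lemma quadN v : quad X (- v) = quad X v.
Proof. by rewrite !quadE mulmxN l2norm_sqrN. Qed.

Lemma quadZ (a : R) v : quad X (a *: v) = a ^+ 2 * quad X v.
Proof. by rewrite !quadE -scalemxAr l2norm_sqrZ mulrA. Qed.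

Lemma pred_err_triangle (f g h : 'cV[R]_n) :
  l2norm (f - h) ^+ 2 / n%:R
    <= 2 * (l2norm (f - g) ^+ 2 / n%:R) + 2 * (l2norm (g - h) ^+ 2 / n%:R).
Proof.
rewrite !(mulrA 2 (_ ^+ 2)) -mulrDl ler_wpM2r ?invr_ge0 ?ler0n//.
by rewrite -[f - h](subrKA g) l2norm_sqrD.
Qed.

Lemma quad_sub_le (f : 'cV[R]_n) u v :
  quad X (u - v) <= 2 * (l2norm (X *m u - f) ^+ 2 / n%:R)
    + 2 * (l2norm (X *m v - f) ^+ 2 / n%:R).
Proof.
rewrite quadE mulmxBr; apply: le_trans (pred_err_triangle _ f _) _.
by rewrite -(l2norm_sqrN (f - _)) opprB.
Qed.

Lemma quad_delta (j : 'I_p) : quad X (delta_mx j 0) = Sigma_hat X j j.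
Proof. by rewrite /quad -mulmxA -colE trmx_delta -rowE 2!mxE. Qed.

(** Cauchy-Schwarz in each row. This makes the set defining [Lambda_max] bounded above, so that its
    supremum dominates its members. *)
Lemma quad_bounded : exists M, forall v, quad X v <= M * l2norm v ^+ 2.
Proof.
exists ((\sum_i \sum_j X i j ^+ 2) / n%:R) => v.
rewrite quadE [leRHS]mulrAC ler_wpM2r ?invr_ge0 ?ler0n//.
rewrite !l2norm_sqr mulr_suml; apply: ler_sum => i _.
by rewrite mxE; exact: (sqr_sum_mul_le xpredT (X i) (fun j => v j 0)).
Qed.

Lemma normalize_supported S v : supported S v -> v != 0 ->
  let u := (l2norm v)^-1 *: v in
  l2norm (restr S u) = 1 /\ quad X v = l2norm v ^+ 2 * quad X (restr S u).
Proof.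
move=> sv v0 u; rewrite (supportedZ _ sv) /u quadZ.
have nv : l2norm v != 0 by rewrite l2norm_eq0.
rewrite l2normZ ?invr_ge0 ?l2norm_ge0// mulVf//.
by rewrite mulrA -exprMn divff// expr1n mul1r.
Qed.

Lemma Lambda_max_ge0 S : 0 <= Lambda_max X S.
Proof. exact: sqrtr_ge0. Qed.

Lemma Lambda_min_ge0 S : 0 <= Lambda_min X S.
Proof. exact: sqrtr_ge0. Qed.

Lemma quad_le_Lambda_max S v : supported S v ->
  quad X v <= Lambda_max X S ^+ 2 * l2norm v ^+ 2.
Proof.
move=> sv; have [->|v0] := eqVneq v 0.
  by rewrite -(scale0r 0) quadZ expr0n mul0r mulr_ge0 ?sqr_ge0.
have [u1 ->] := normalize_supported sv v0.
rewrite mulrC ler_wpM2r ?sqr_ge0// /Lambda_max.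
set q := quad X _; set E := (E in sup E).
have ubE : has_ubound E.
  have [M hM] := quad_bounded; exists M => _ [w [w1 ->]].
  by rewrite (le_trans (hM _))// w1 expr1n mulr1.
have qE : q <= sup E by apply: ub_le_sup => //; exists ((l2norm v)^-1 *: v).
by rewrite sqr_sqrtr// (le_trans _ qE)// quad_ge0.
Qed.

Lemma quad_le_Lambda_sparse S v : supported S v ->
  quad X v <= Lambda_sparse X #|S| ^+ 2 * l2norm v ^+ 2.
Proof.
move=> sv; apply: le_trans (quad_le_Lambda_max sv) _.
rewrite ler_wpM2r ?sqr_ge0//.
have le_sparse : Lambda_max X S <= Lambda_sparse X #|S|.
  apply: ub_le_sup; last by exists S.
  (* Any upper bound will do; the sum of the nonnegative values over all sets is one. *)
  exists (\sum_(T : {set 'I_p}) Lambda_max X T) => _ [T [_ ->]].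
  by rewrite (bigD1 T)//= lerDl sumr_ge0// => *; exact: Lambda_max_ge0.
rewrite ler_sqr// nnegrE ?Lambda_max_ge0//.
exact: le_trans (Lambda_max_ge0 S) le_sparse.
Qed.

Lemma Lambda_min_le_quad S v : supported S v ->
  Lambda_min X S ^+ 2 * l2norm v ^+ 2 <= quad X v.
Proof.
move=> sv; have [->|v0] := eqVneq v 0.
  rewrite -(scale0r 0) quadZ expr0n mul0r.
  by rewrite l2norm_sqrZ expr0n mul0r mulr0.
have [u1 ->] := normalize_supported sv v0.
rewrite mulrC ler_wpM2l ?sqr_ge0// /Lambda_min.
set q := quad X _; set E := (E in inf E).
have Eq : E q by exists ((l2norm v)^-1 *: v).
have E0 : lbound E 0 by move=> _ [w [_ ->]]; exact: quad_ge0.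
rewrite sqr_sqrtr; last by apply: lb_le_inf => //; exists q.
by apply: ge_inf => //; exists 0.
Qed.

Lemma phi_sparse_le_quad S T v : S \subset T -> supported T v ->
  phi_sparse X S #|T| ^+ 2 * l2norm v ^+ 2 <= quad X v.
Proof.
move=> ST sv; apply: le_trans (Lambda_min_le_quad sv).
rewrite ler_wpM2r ?sqr_ge0//.
set E := fun x : R => exists NN : {set 'I_p},
  [/\ S \subset NN, #|NN| = #|T| & x = Lambda_min X NN].
have ET : E (Lambda_min X T) by exists T.
have E0 : lbound E 0 by move=> _ [U [_ _ ->]]; exact: Lambda_min_ge0.
rewrite ler_sqr ?nnegrE ?Lambda_min_ge0//; last first.
  by apply: lb_le_inf => //; exists (Lambda_min X T).
by apply: ge_inf => //; exists 0.
Qed.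

Lemma phi_le_quad L S T N v : S \subset T -> (#|T| <= N)%N ->
  restricted_set L S T v ->
  phi X L S N ^+ 2 * l2norm (restr T v) ^+ 2 <= quad X v.
Proof.
move=> ST TN vR; have [->|v0] := eqVneq (restr T v) 0.
  rewrite -(scale0r 0) l2norm_sqrZ expr0n mul0r mulr0; exact: quad_ge0.
have n_gt0 : 0 < l2norm (restr T v) ^+ 2.
  by rewrite lt_def sqrf_eq0 l2norm_eq0 v0 sqr_ge0.
rewrite -ler_pdivlMr// /phi /phi2; set q := quad X v / _; set E := (E in inf E).
have Eq : E q by exists T, v.
have E0 : lbound E 0.
  by move=> _ [U [w [_ _ _ _ ->]]]; rewrite divr_ge0 ?quad_ge0 ?sqr_ge0.
rewrite sqr_sqrtr; last by apply: lb_le_inf => //; exists q.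
by apply: ge_inf => //; exists 0.
Qed.

(** Trades the comparison of an extended-real maximum and minimum for one of pairs of coordinates.
    Empty index sets are covered by the values -oo and +oo. *)
Lemma restricted_setI L S T v :
  l1norm (restr (~: T)%SET v) <= L * Num.sqrt #|T|%:R * l2norm (restr T v) ->
  (forall j k, j \notin T -> k \in T :\: S -> `|v j 0| <= `|v k 0|) ->
  restricted_set L S T v.
Proof.
move=> l1 dom; split=> //; apply: bigmax_le => [|j]; first exact: leNye.
rewrite inE => jT; apply: le_bigmin => [|k kT]; first exact: leey.
by rewrite lee_fin dom.
Qed.

(** Off [T] the vector vanishes, so both conditions are trivial. This makes [phi] available for
    refit errors without a cone argument. *)
Lemma supported_restricted_set L S T v : 0 <= L -> supported T v ->
  restricted_set L S T v.
Proof.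
move=> L0 sv; apply: restricted_setI => [|j k jT _].
  by rewrite supported_restrC// l1norm0 !mulr_ge0 ?sqrtr_ge0 ?l2norm_ge0.
by move/supportedP: sv => ->//; rewrite normr0.
Qed.

(** A larger [N] admits more competitors. Positivity of [phi X L S N] guarantees that there is a
    competitor at all, since the infimum of the empty set is 0. *)
Lemma phi_le_phi L S N N' : (N <= N')%N -> 0 < phi X L S N ->
  phi X L S N' <= phi X L S N.
Proof.
move=> NN'; rewrite sqrtr_gt0 => phi_gt0; apply: ler_wsqrtr.
have [_ [T [v [ST TN vR v0 _]]]] : nonempty
    (fun x : R => exists NN : {set 'I_p}, exists beta,
      [/\ S \subset NN, (#|NN| <= N)%N, restricted_set L S NN beta,
        restr NN beta != 0
      & x = quad X beta / l2norm (restr NN beta) ^+ 2]).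
  by apply: contrapT => /nonemptyPn E; move: phi_gt0; rewrite /phi2 E inf0 ltxx.
apply: lb_le_inf; first by exists (quad X v / l2norm (restr T v) ^+ 2), T, v.
move=> _ [U [w [SU UN wR w0 ->]]]; apply: ge_inf.
  exists 0 => _ [V [z [_ _ _ _ ->]]].
  by rewrite divr_ge0 ?quad_ge0 ?sqr_ge0.
by exists U, w; split=> //; exact: leq_trans NN'.
Qed.

Lemma phi_ge0 L S N : 0 <= phi X L S N.
Proof. exact: sqrtr_ge0. Qed.

Lemma l2norm_delta (j : 'I_p) : l2norm (delta_mx j 0 : 'cV[R]_p) ^+ 2 = 1.
Proof.
rewrite l2norm_sqr (bigD1 j)//= big1 => [|k /negbTE kj]; rewrite !mxE.
  by rewrite !eqxx expr1n addr0.
by rewrite kj expr0n.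
Qed.

Lemma supported_delta S j : j \in S -> supported S (delta_mx j 0 : 'cV[R]_p).
Proof.
move=> jS; apply/supportedP => k kS; rewrite mxE.
by case: eqP kS => [->|//]; rewrite jS.
Qed.

(** The basis vector at [j] is a competitor whose quotient is the diagonal entry 1. *)
Lemma phi_le1 L S N j : 0 <= L -> j \in S -> (#|S| <= N)%N ->
  Sigma_hat X j j = 1 -> phi X L S N <= 1.
Proof.
move=> L0 jS SN Sj; have sj := supported_delta jS.
have := phi_le_quad (fintype.subxx S) SN (supported_restricted_set S L0 sj).
by rewrite sj quad_delta Sj l2norm_delta mulr1 expr_le1// phi_ge0.
Qed.

Lemma Lambda_sparse_sqr_ge1 S j : j \in S -> Sigma_hat X j j = 1 ->
  1 <= Lambda_sparse X #|S| ^+ 2.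
Proof.
move=> jS Sj; have := quad_le_Lambda_sparse (supported_delta jS).
by rewrite quad_delta Sj l2norm_delta mulr1.
Qed.

Lemma Lambda_sparse_ge0 N : 0 <= Lambda_sparse X N.
Proof.
rewrite /Lambda_sparse; set E := (E in sup E).
(* If no set has [N] elements, the supremum takes its default value 0. *)
have [[_ [T [cT _]]]|/nonemptyPn ->] := pselect (nonempty E).
  2: by rewrite sup0.
apply: le_trans (Lambda_max_ge0 T) _; apply: ub_le_sup; last by exists T.
exists (\sum_(T : {set 'I_p}) Lambda_max X T) => _ [U [_ ->]].
by rewrite (bigD1 U)//= lerDl sumr_ge0// => *; exact: Lambda_max_ge0.
Qed.

(** * Consequences of the noise event *)

(** Duality of the l1 and max norms after moving [X] onto [eps]. The factor 4 in the event leaves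
    half of [lambda]. *)
Lemma noise_event_dot (lambda : R) (eps : 'cV[R]_n) v :
  noise_event X lambda eps ->
  2 * (\sum_i eps i 0 * (X *m v) i 0) / n%:R <= lambda / 2 * l1norm v.
Proof.
rewrite /noise_event; set M := (\big[Num.max/0]_(j < p) _) => hM.
have -> : \sum_i eps i 0 * (X *m v) i 0
    = \sum_j (eps^T *m col j X) 0 0 * v j 0.
  under eq_bigr do rewrite mxE mulr_sumr.
  rewrite exchange_big; apply: eq_bigr => j _; rewrite mxE mulr_suml.
  by apply: eq_bigr => i _; rewrite !mxE mulrA.
have : \sum_j (eps^T *m col j X) 0 0 / n%:R * v j 0 <= M * l1norm v.
  rewrite mulr_sumr; apply: ler_sum => j _.
  apply: le_trans (ler_norm _) _; rewrite normrM ler_wpM2r//.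
  exact: (le_bigmax 0 (fun j => `|(eps^T *m col j X) 0 0 / n%:R|) j).
under eq_bigr do rewrite mulrAC.
rewrite -mulr_suml -mulrA => h.
by have := l1norm_ge0 v; nra.
Qed.

(** Expanding the squares around [f], the terms in [eps] alone cancel and only the cross term with
    [X *m (u - v)] remains. *)
Lemma noise_event_pred_err (lambda : R) (eps f : 'cV[R]_n) u v :
  noise_event X lambda eps ->
  l2norm (X *m u - f) ^+ 2 / n%:R - l2norm (X *m v - f) ^+ 2 / n%:R
    <= l2norm (f + eps - X *m u) ^+ 2 / n%:R
       - l2norm (f + eps - X *m v) ^+ 2 / n%:R + lambda / 2 * l1norm (u - v).
Proof.
move=> /(noise_event_dot (u - v)); rewrite -lerBlDl; apply: le_trans.
rewrite -!mulrBl -opprB -opprB opprK ler_wpM2r ?invr_ge0 ?ler0n// mulmxBr.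
rewrite !l2norm_sqr mulr_sumr -!sumrB; apply: ler_sum => i _.
by rewrite !mxE; nra.
Qed.

End Quad.

(** * Prediction bounds for the Lasso and for the refit *)

Section Lasso.
Variables (R : realType) (n p : nat) (X : 'M[R]_(n, p)).
Variables (f eps : 'cV[R]_n) (lambda : R).
Hypotheses (lambda_gt0 : 0 < lambda) (noise : noise_event X lambda eps).
Implicit Types (v : 'cV[R]_p) (S T : {set 'I_p}).

Let pred_err v := l2norm (X *m v - f) ^+ 2 / n%:R.

Let pred_err_ge0 v : 0 <= pred_err v.
Proof. by rewrite divr_ge0 ?sqr_ge0. Qed.

(** Optimality against [b0] bounds the change in fit by [lambda] times [D1 - D2], because [b0]
    vanishes off [S]. The noise costs half of [lambda] on each part, which turns the weights into
    3/2 on [S] and 1/2 off it. *)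
Lemma lasso_basic_inequality S b0 beta :
  supported S b0 -> is_lasso X (f + eps) lambda beta ->
  pred_err beta + lambda / 2 * l1norm (restr (~: S)%SET (beta - b0))
    <= pred_err b0 + 3 / 2 * lambda * l1norm (restr S (beta - b0)).
Proof.
move=> sb /(_ b0); rewrite /lasso_objective => opt.
have := noise_event_pred_err f beta b0 noise.
rewrite -/(pred_err _) -/(pred_err _) (l1norm_split S (beta - b0)).
set D1 := l1norm (restr S _); set D2 := l1norm _ => h.
have b0_eq : l1norm b0 = l1norm (restr S b0) by rewrite sb.
have b0_le : l1norm b0 <= l1norm (restr S beta) + D1.
  rewrite b0_eq /D1 !l1norm_restr -big_split; apply: ler_sum => j _ /=.
  have -> : b0 j 0 = beta j 0 - (beta - b0) j 0 by rewrite !mxE; ring.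
  exact: ler_normB.
have beta_eq : l1norm beta = l1norm (restr S beta) + D2.
  rewrite (l1norm_split S beta); congr (_ + _); rewrite /D2 !l1norm_restr.
  apply: eq_bigr => j; rewrite inE => jS.
  by move/supportedP: sb => /(_ j jS) b0j; rewrite !mxE b0j subr0.
have : lambda * (l1norm b0 - l1norm beta) <= lambda * (D1 - D2).
  by rewrite (ler_wpM2l (ltW lambda_gt0))// beta_eq; lra.
by rewrite mulrBr mulrBr; lra.
Qed.

Lemma lasso_pred_l1_bound (A : R) S b0 beta (phi1 := phi_card X 6 S)
    (w := lambda ^+ 2 * #|S|%:R / phi1 ^+ 2) :
  0 < A -> 0 < phi1 -> supported S b0 ->
  is_lasso X (f + eps) lambda beta -> pred_err b0 <= A * w ->
  quad X (beta - b0) <= (42 + 6 * A) * w /\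
  lambda * l1norm (beta - b0) <= (42 + 6 * A) * w.
Proof.
move=> A_gt0 phi_gt0 sb lasso E_le.
have := lasso_basic_inequality sb lasso.
have := quad_sub_le X f beta b0; rewrite -/(pred_err _) -/(pred_err _).
rewrite (l1norm_split S (beta - b0)).
set d := beta - b0; set D1 := l1norm (restr S d); set D2 := l1norm _.
have := pred_err_ge0 beta; have := pred_err_ge0 b0.
move: E_le; set P := pred_err beta; set E := pred_err b0; set Q := quad X d.
move=> E_le E0 P0 QPE basic.
have D1_ge0 : 0 <= D1 by exact: l1norm_ge0.
have D2_ge0 : 0 <= D2 by exact: l1norm_ge0.
have Q_ge0 : 0 <= Q by exact: quad_ge0.
have w_ge0 : 0 <= w by rewrite divr_ge0 ?sqr_ge0// mulr_ge0 ?sqr_ge0.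
have Aw_ge0 : 0 <= A * w by rewrite mulr_ge0// ltW.
set x := lambda * D1; set y := lambda * D2.
have x0 : 0 <= x by rewrite mulr_ge0// ltW.
have y0 : 0 <= y by rewrite mulr_ge0// ltW.
have {}basic : P + y / 2 <= E + 3 / 2 * x.
  by move: basic; rewrite /x /y; lra.
rewrite !mulrDr mulrDl -/x -/y -[6 * A * w]mulrA.
(* If the approximation error [E] dominates, everything is at most [6 * E]. Otherwise the basic
   inequality gives [y <= 6 * x], which is the cone with constant 6. *)
have [big|small] := ltP (3 * x) (2 * E); first by split; lra.
have D2_le : D2 <= 6 * D1.
  by rewrite -(ler_pM2l lambda_gt0) -/y mulrCA -/x; lra.
have D1_sqr : D1 ^+ 2 <= #|S|%:R * l2norm (restr S d) ^+ 2.
  exact: l1norm_restr_sqr_le.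
have cone : restricted_set 6 S S d.
  apply: restricted_setI => [|j k _]; last by rewrite finset.setDv inE.
  apply: le_trans D2_le _; rewrite -mulrA ler_wpM2l//.
  rewrite -ler_sqr ?nnegrE ?mulr_ge0 ?sqrtr_ge0 ?l2norm_ge0//.
  by rewrite exprMn sqr_sqrtr.
have := phi_le_quad X (fintype.subxx S) (leqnn _) cone.
rewrite -/(phi_card X 6 S) -/phi1 -/Q => phi_Q.
(* The weight 1/12 is small enough for absorption: [Q <= 4 * E + 3 * x] then has only [Q / 4] on its
   right. *)
have x_le : x <= Q / 12 + 3 * w.
  apply: le_add_of_sqr_le_mul; [by rewrite divr_ge0 | by rewrite mulr_ge0 |].
  have -> : 4 * (Q / 12 * (3 * w)) = w * Q by field.
  apply: (@le_trans _ _ (w * (phi1 ^+ 2 * l2norm (restr S d) ^+ 2))).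
    rewrite /x exprMn /w mulrA divfK ?sqrf_eq0 ?gt_eqF// -mulrA.
    by rewrite ler_wpM2l ?sqr_ge0.
  by rewrite ler_wpM2l.
by split; lra.
Qed.

(** Since [v] is admissible for the refit, the excess error is only the noise term in [d]. As [d]
    lives on at most [2 * #|S|] coordinates, [phi] bounds its l1 norm by its prediction norm, which
    is absorbed. *)
Lemma refit_pred_bound S St v bt
    (w := lambda ^+ 2 * #|S|%:R / phi X 6 S (2 * #|S|)%N ^+ 2) :
  0 < phi X 6 S (2 * #|S|)%N -> (#|St :\: S| <= #|S|)%N -> supported St v ->
  least_squares_on X (f + eps) St bt ->
  pred_err bt <= 2 * pred_err v + 2 * w.
Proof.
move=> phi_gt0 cSt sv [sbt /(_ v sv) opt].
have := noise_event_pred_err f bt v noise.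
have := quad_sub_le X f bt v; rewrite -!/(pred_err _).
have := pred_err_ge0 v; have := pred_err_ge0 bt.
set G := pred_err bt; set F := pred_err v; set d := bt - v; set q := quad X d.
move=> G0 F0 q_le basic.
set T := (S :|: St)%SET.
have cT : (#|T| <= 2 * #|S|)%N.
  by rewrite cardsU_setD mul2n -addnn leq_add2l.
have sd : supported T d.
  by apply: supported_sub (finset.subsetUr S St) _; exact: supportedB.
have := phi_le_quad X (finset.subsetUl S St) cT
  (supported_restricted_set S (ler0n R 6) sd).
rewrite sd -/q => phi_q.
have w_ge0 : 0 <= w by rewrite divr_ge0 ?sqr_ge0// mulr_ge0 ?sqr_ge0.
have q_ge0 : 0 <= q by exact: quad_ge0.
(* Half of this enters the basic inequality; [q / 8] is at most [(G + F) / 4], so [G] can be solved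
   for. *)
have : lambda * l1norm d <= q / 4 + 2 * w.
  apply: le_add_of_sqr_le_mul; [by rewrite divr_ge0 | by rewrite mulr_ge0 |].
  have -> : 4 * (q / 4 * (2 * w)) = 2 * w * q by field.
  apply: (@le_trans _ _ (2 * w * (phi X 6 S (2 * #|S|) ^+ 2 * l2norm d ^+ 2))).
    have -> : 2 * w * (phi X 6 S (2 * #|S|) ^+ 2 * l2norm d ^+ 2)
        = lambda ^+ 2 * ((2 * #|S|)%:R * l2norm d ^+ 2).
      by rewrite /w natrM; field; rewrite gt_eqF.
    rewrite exprMn ler_wpM2l ?sqr_ge0//.
    apply: le_trans (l1norm_sqr_le sd) _.
    by rewrite ler_wpM2r ?sqr_ge0// ler_nat.
  by apply: ler_wpM2l => //; rewrite mulr_ge0.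
by move: basic; rewrite mulrAC; lra.
Qed.

End Lasso.

(* Either 'v' lies in the restricted set of the dominating superset 'T' of 'S',
   or its l2 norm on 'T' is controlled by its l1 norm. *)
Lemma l2norm_sqr_bound (R : realType) (n p : nat) (X : 'M[R]_(n, p))
    (S : {set 'I_p}) (v : 'cV[R]_p) (K m : R)
    (phi2s := phi X 6 S (2 * #|S|)%N) :
  1 <= K -> 0 <= m -> (0 < #|S|)%N -> (2 * #|S| <= p)%N -> 0 < phi2s ->
  quad X v <= K * (m ^+ 2 * phi2s ^+ 2 * #|S|%:R) ->
  l1norm v <= K * (m * #|S|%:R) ->
  l2norm v ^+ 2 <= 2 * K ^+ 2 * (m ^+ 2 * #|S|%:R).
Proof.
move=> K1 m0 S0 Sp phi_gt0 quad_le l1_le.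
rewrite mul2n -addnn in Sp.
(* Adding exactly [#|S|] coordinates fits both uses: [T] has the size allowed in [phi2s], and the
   tail bound may divide by [#|S|]. *)
have [T [ST cT dom]] := dominating_superset v Sp.
rewrite addnn -mul2n in cT.
have r_gt0 : 0 < #|S|%:R :> R by rewrite ltr0n.
have K0 : 0 <= K by lra.
have l1_sqr (u : 'cV[R]_p) : 0 <= l1norm u <= l1norm v ->
    l1norm u ^+ 2 <= #|S|%:R * (K ^+ 2 * (m ^+ 2 * #|S|%:R)).
  move=> /andP[u0 uv].
  have -> : #|S|%:R * (K ^+ 2 * (m ^+ 2 * #|S|%:R))
      = (K * (m * #|S|%:R)) ^+ 2 by ring.
  by rewrite ler_sqr ?nnegrE ?mulr_ge0 ?(ltW r_gt0)// (le_trans uv).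
have restr_le U : 0 <= l1norm (restr (~: U)%SET v) <= l1norm v.
  by rewrite (l1norm_split U v) l1norm_ge0 lerDr l1norm_ge0.
(* One share of the bound goes to the coordinates in [T], the other to the tail. *)
have -> : 2 * K ^+ 2 * (m ^+ 2 * #|S|%:R)
    = K ^+ 2 * (m ^+ 2 * #|S|%:R) + K ^+ 2 * (m ^+ 2 * #|S|%:R) by ring.
rewrite (l2norm_sqr_split T v) lerD//; last first.
  rewrite -(ler_pM2l r_gt0); apply: le_trans _ (l1_sqr _ (restr_le S)).
  apply: l2norm_sqr_tail => //.
  by rewrite cardsDS// cT mul2n -addnn addKn.
have [cone|far] :=
  leP (l1norm (restr (~: T)%SET v)) (6 * Num.sqrt #|T|%:R * l2norm (restr T v)).
  have cT_le : (#|T| <= 2 * #|S|)%N by rewrite cT.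
  have := phi_le_quad X ST cT_le (restricted_setI cone dom).
  rewrite -/phi2s => /le_trans /(_ quad_le) h.
  apply: (@le_trans _ _ (K * (m ^+ 2 * #|S|%:R))).
    rewrite -(ler_pM2l (exprn_gt0 2 phi_gt0)); apply: le_trans h _.
    by rewrite le_eqVlt; apply/orP; left; apply/eqP; ring.
  by rewrite ler_wpM2r ?mulr_ge0 ?sqr_ge0// expr2 ler_peMl.
have far0 : 0 <= 6 * Num.sqrt #|T|%:R * l2norm (restr T v).
  by rewrite !mulr_ge0 ?sqrtr_ge0 ?l2norm_ge0.
have := l1_sqr _ (restr_le T).
have : (6 * Num.sqrt #|T|%:R * l2norm (restr T v)) ^+ 2
    <= l1norm (restr (~: T)%SET v) ^+ 2.
  by rewrite ler_sqr ?nnegrE ?l1norm_ge0// ltW.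
rewrite !exprMn sqr_sqrtr// cT natrM => h1 h2.
rewrite -(ler_pM2l r_gt0); apply: le_trans _ (le_trans h1 h2).
have : 0 <= #|S|%:R * l2norm (restr T v) ^+ 2 by rewrite mulr_ge0 ?sqr_ge0.
lra.
Qed.

(** * Selection error and bias of thresholding *)

Section Thresholding.
Variables (R : realType) (p : nat) (S : {set 'I_p}).
Variables (b0 beta : 'cV[R]_p) (tau : R).
Hypotheses (tau_gt0 : 0 < tau) (sb0 : supported S b0).
Let St := threshold_set tau beta.

(** A Chebyshev count: off [S] a selected coordinate of [beta] exceeds [tau] while [b0] is zero, so
    it adds more than [tau ^+ 2] to the squared error. *)
Lemma threshold_false_positives :
  #|St :\: S|%:R * tau ^+ 2 <= l2norm (beta - b0) ^+ 2.
Proof.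
rewrite (l2norm_sqr_split (St :\: S)) -[leLHS]addr0 lerD ?sqr_ge0//.
rewrite l2norm_restr_sqr mulr_natl -sumr_const; apply: ler_sum => j.
rewrite !inE => /andP[jS jSt]; move/supportedP: sb0 => /(_ j jS) b0j.
rewrite !mxE b0j subr0 -[leRHS]real_normK ?num_real//.
by rewrite ler_sqr ?nnegrE ?(ltW tau_gt0)// ltW.
Qed.

(** Selected coordinates, and those off [S], contribute nothing. A lost coordinate of [S] has [beta]
    at most [tau] in modulus, and [b0] differs from it by the estimation error. *)
Lemma threshold_bias :
  l2norm (b0 - restr St b0) ^+ 2
    <= 2 * (tau ^+ 2 * #|S|%:R) + 2 * l2norm (beta - b0) ^+ 2.
Proof.
have -> : tau ^+ 2 * #|S|%:R = \sum_j (if j \in S then tau ^+ 2 else 0).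
  by rewrite -big_mkcond sumr_const mulr_natr.
rewrite !l2norm_sqr !mulr_sumr -big_split; apply: ler_sum => j _ /=.
have := sqr_ge0 ((beta - b0) j 0); rewrite !mxE.
have [jSt|jSt] := boolP (j \in St); rewrite (mulr1, mulr0).
  rewrite subrr expr0n /=; case: ifP => _ h.
    by have := sqr_ge0 tau; lra.
  by lra.
case: ifPn => [_|jS] h.
  have tau_j : beta j 0 ^+ 2 <= tau ^+ 2.
    move: jSt; rewrite inE -leNgt => jtau.
    by rewrite -[leLHS]real_normK ?num_real// ler_sqr ?nnegrE ?(ltW tau_gt0).
  have := sqrD_le (beta j 0) (- (beta j 0 - b0 j 0)).
  have -> : beta j 0 - (beta j 0 - b0 j 0) = b0 j 0 by ring.
  by rewrite sqrrN subr0; lra.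
move/supportedP: sb0 => /(_ j jS) b0j; move: h; rewrite b0j !subr0 expr0n /=.
lra.
Qed.

End Thresholding.

(** * Choice of the constants and proof of the four bounds *)

Theorem theorem3p2 (R : realType) (A : R) (A_gt0 : 0 < A) :
  exists c C : R, 0 < c /\ 0 < C /\
  forall (n p : nat) (X : 'M[R]_(n, p)) (beta_true : 'cV[R]_p)
    (eps : 'cV[R]_n) (lambda_init lambda_thres : R)
    (b : {set 'I_p} -> 'cV[R]_p) (S0 : {set 'I_p})
    (beta_init b_thres : 'cV[R]_p),
  let f0 := X *m beta_true in
  let Y := f0 + eps in
  let b0 := b S0 in
  let s0 := #|S0| in
  let S_thres := threshold_set lambda_thres beta_init in
  (n <= p)%N ->
  (forall j : 'I_p, Sigma_hat X j j = 1) ->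
  0 < lambda_init ->
  0 < lambda_thres ->
  (forall S : {set 'I_p}, least_squares_on X f0 S (b S)) ->
  is_oracle_set X f0 b lambda_init (support_set beta_true) S0 ->
  (1 <= s0)%N ->
  (2 * s0 <= p)%N ->
  0 < phi_card X 6 S0 ->
  0 < phi X 6 S0 (2 * s0)%N ->
  0 < phi_sparse X S0 (2 * s0)%N ->
  is_lasso X Y lambda_init beta_init ->
  least_squares_on X Y S_thres b_thres ->
  l2norm (X *m b0 - f0) ^+ 2 / n%:R
    <= A * (lambda_init ^+ 2 * s0%:R / phi_card X 6 S0 ^+ 2) ->
  lambda_init / phi X 6 S0 (2 * s0)%N ^+ 2 <= c * lambda_thres ->
  noise_event X lambda_init eps ->
  [/\ l2norm (X *m b_thres - f0) ^+ 2 / n%:R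
        <= C * Lambda_sparse X s0 ^+ 2 * (lambda_thres ^+ 2 / lambda_init ^+ 2)
             * (lambda_init ^+ 2 * s0%:R),
      l1norm (b_thres - b0)
        <= C * (Lambda_sparse X s0 / phi_sparse X S0 (2 * s0)%N)
             * (lambda_thres / lambda_init) * (lambda_init * s0%:R),
      l2norm (b_thres - b0)
        <= C * (Lambda_sparse X s0 / phi_sparse X S0 (2 * s0)%N)
             * (lambda_thres / lambda_init)
             * (lambda_init * Num.sqrt s0%:R)
    & #|S_thres :\: S0|%:R
        <= C * (1 / phi X 6 S0 (2 * s0)%N ^+ 4)
             * (lambda_init ^+ 2 / lambda_thres ^+ 2) * s0%:R].
Proof.
(* [K0] is the constant of [lasso_pred_l1_bound], and [K] below that of [l2norm_sqr_bound];
   [c = K^-1] turns the tuning condition into [K * m <= tau]. *)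
set K0 := 42 + 6 * A.
have K0_ge1 : 1 <= K0 by rewrite /K0; lra.
have K0_sqr : 42 * K0 <= K0 ^+ 2 by rewrite expr2 ler_wpM2r// /K0; lra.
set K := 2 * K0 ^+ 2.
have K_gt0 : 0 < K by rewrite /K; lra.
exists K^-1, K; rewrite invr_gt0; split=> //; split=> //.
move=> n p X beta_true eps lam tau b S0 beta_init bt f0 Y b0 s0 St _ norm1.
move=> lam_gt0 tau_gt0 ls _ s0_ge1 s0p phi1_gt0 phi_gt0 phs_gt0 lasso refit.
move=> E_le tau_ge noise.
have sb0 : supported S0 b0 by case: (ls S0).
set r : R := s0%:R; have r_gt0 : 0 < r by rewrite ltr0n.
set phi1 := phi_card X 6 S0 in phi1_gt0 E_le *.
set ph := phi X 6 S0 (2 * s0)%N in phi_gt0 tau_ge *.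
set phs := phi_sparse _ _ _ in phs_gt0 *.
set Lam := Lambda_sparse X s0.
set m := lam / ph ^+ 2 in tau_ge.
have m_ge0 : 0 <= m by rewrite divr_ge0 ?sqr_ge0 ?ltW.
have [j0 j0S] : exists j, j \in S0 by apply/card_gt0P.
have ph_le1 : ph ^+ 2 <= 1.
  rewrite expr_le1 ?(ltW phi_gt0)//.
  by apply: (phi_le1 _ j0S) => //; rewrite mul2n -addnn leq_addr.
have Lam_ge1 : 1 <= Lam ^+ 2 by exact: (Lambda_sparse_sqr_ge1 j0S).
have Lam_ge0 : 0 <= Lam by exact: Lambda_sparse_ge0.
have ph2_gt0 : 0 < ph ^+ 2 by rewrite exprn_gt0.
set w := lam ^+ 2 * r / ph ^+ 2.
have w_m : w = m ^+ 2 * ph ^+ 2 * r by rewrite /w /m; field; rewrite gt_eqF.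
(* Passes from [phi1] to the smaller [ph], in which all later rates are expressed. *)
have w1_le : lam ^+ 2 * r / phi1 ^+ 2 <= w.
  rewrite /w ler_wpM2l ?mulr_ge0 ?(ltW lam_gt0) ?(ltW r_gt0)//.
  rewrite lef_pV2 ?posrE ?exprn_gt0//.
  rewrite ler_sqr ?nnegrE ?(ltW phi_gt0) ?(ltW phi1_gt0)//.
  by apply: phi_le_phi phi1_gt0; rewrite mul2n -addnn leq_addr.
have Km : K * m <= tau.
  by rewrite -(ler_pM2l (_ : 0 < K^-1)) ?invr_gt0// mulrA mulVf ?mul1r// gt_eqF.
have tau2_ge0 : 0 <= tau ^+ 2 by exact: sqr_ge0.
have m2_ge0 : 0 <= m ^+ 2 by exact: sqr_ge0.
have Km2 : K * m ^+ 2 <= tau ^+ 2.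
  apply: (@le_trans _ _ ((K * m) ^+ 2)).
    by rewrite [leRHS]exprMn ler_wpM2r// expr2 ler_peMl ?(ltW K_gt0)// /K; lra.
  by rewrite ler_sqr ?nnegrE ?(ltW tau_gt0)// mulr_ge0// ltW.
have m2_le : m ^+ 2 <= tau ^+ 2.
  by apply: le_trans Km2; rewrite ler_peMl// /K; lra.
have [quad_le l1_le] :=
  lasso_pred_l1_bound lam_gt0 noise A_gt0 phi1_gt0 sb0 lasso E_le.
rewrite -/K0 in quad_le l1_le.
set d := beta_init - b0 in quad_le l1_le.
have K0_ge0 : 0 <= K0 by lra.
have d_le : l2norm d ^+ 2 <= K * (m ^+ 2 * r).
  apply: (l2norm_sqr_bound (X := X)) => //.
    by apply: le_trans quad_le _; rewrite -/ph -w_m ler_wpM2l.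
  rewrite -(ler_pM2l lam_gt0); apply: le_trans l1_le _.
  apply: (@le_trans _ _ (K0 * w)); first by rewrite ler_wpM2l.
  rewrite le_eqVlt; apply/orP; left; apply/eqP.
  by rewrite /w /m /r; field; rewrite gt_eqF.
have fp := threshold_false_positives beta_init tau_gt0 sb0.
rewrite -/St -/d in fp.
have card_le : #|St :\: S0|%:R * tau ^+ 2 <= K * (m ^+ 2 * r).
  exact: le_trans d_le.
have cSt : (#|St :\: S0| <= s0)%N.
  rewrite -(ler_nat R) -/r -(ler_pM2r (exprn_gt0 2 tau_gt0)).
  by apply: le_trans card_le _; rewrite mulrA [leRHS]mulrC ler_wpM2r// ltW.
set M := Lam ^+ 2 * (tau ^+ 2 * r).
have tr_ge0 : 0 <= tau ^+ 2 * r by rewrite mulr_ge0// ltW.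
have tr_le : tau ^+ 2 * r <= M by rewrite /M ler_peMl.
have M_ge0 : 0 <= M by exact: le_trans tr_le.
(* Here the leftover [ph] disappears: [ph ^+ 2 <= 1 <= Lam ^+ 2] and [m ^+ 2 <= tau ^+ 2]. *)
have w_le : w <= M.
  apply: le_trans tr_le; rewrite w_m ler_wpM2r ?(ltW r_gt0)//.
  by apply: le_trans m2_le; rewrite ler_piMr.
set E := l2norm (X *m b0 - f0) ^+ 2 / n%:R in E_le.
have E_le_M : E <= A * M.
  apply: le_trans E_le _; rewrite ler_wpM2l ?(ltW A_gt0)//.
  exact: le_trans w_le.
pose v := restr St b0.
have bias : l2norm (b0 - v) ^+ 2 <= 4 * (tau ^+ 2 * r).
  have := threshold_bias beta_init tau_gt0 sb0; rewrite -/St -/v -/d -/r.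
  have : K * (m ^+ 2 * r) <= tau ^+ 2 * r.
    by rewrite mulrA ler_wpM2r// ltW.
  by lra.
have sbv : supported S0 (b0 - v).
  apply: supportedB => //; apply/supportedP => j jS.
  by move/supportedP: sb0 => /(_ j jS) b0j; rewrite mxE b0j mul0r.
have quad_bias : quad X (b0 - v) <= 4 * M.
  apply: le_trans (quad_le_Lambda_sparse X sbv) _.
  by rewrite -/Lam /M [leRHS]mulrCA ler_wpM2l// sqr_ge0.
have F_le : l2norm (X *m v - f0) ^+ 2 / n%:R <= (8 + 2 * A) * M.
  apply: le_trans (pred_err_triangle _ (X *m b0) _) _.
  rewrite -/E -mulmxBr -quadE -[v - b0]opprB quadN; lra.
have G_le : l2norm (X *m bt - f0) ^+ 2 / n%:R <= (18 + 4 * A) * M.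
  have := refit_pred_bound noise phi_gt0 cSt (supported_restr St b0) refit.
  rewrite -/v -/w; lra.
have AM_ge0 : 0 <= A * M by rewrite mulr_ge0// ltW.
have K_ge : 72 + 20 * A <= K.
  by apply: (@le_trans _ _ (84 * K0)); [rewrite /K0; lra | rewrite /K; lra].
have KM : (72 + 20 * A) * M <= K * M by rewrite ler_wpM2r.
(* The constant [72 + 20 * A] is [4 * (18 + 4 * A) + 4 * A], from the errors of [bt] and [b0]. The
   factor 2 on the left is kept to pay for the support size [2 * s0] in the l1 bound. *)
have q_le : 2 * quad X (bt - b0) <= K * M.
  have := quad_sub_le X f0 bt b0; rewrite -/E. lra.
have cU : (#|S0 :|: St| <= 2 * s0)%N.
  by rewrite cardsU_setD mul2n -addnn leq_add2l.
have sU : supported (S0 :|: St) (bt - b0).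
  apply: supportedB.
    by apply: supported_sub (finset.subsetUr _ _) _; case: refit.
  by apply: supported_sub (finset.subsetUl _ _) _.
have l2_le : 2 * (phs ^+ 2 * l2norm (bt - b0) ^+ 2) <= K * M.
  (* [phi_sparse] ranges over sets of exactly [2 * s0] elements, so the support is padded to that
     size; only the cardinality of [T] matters here. *)
  have Up : (#|S0 :|: St| + (2 * s0 - #|S0 :|: St|) <= p)%N by rewrite subnKC.
  have [T [UT cT _]] := dominating_superset (bt - b0) Up.
  rewrite subnKC// in cT.
  have S0T := fintype.subset_trans (finset.subsetUl S0 St) UT.
  have := phi_sparse_le_quad X S0T (supported_sub UT sU); rewrite cT -/phs; lra.
have K_ge1 : 1 <= K by lra.
have KM_le : K * M <= K ^+ 2 * M by rewrite ler_wpM2r// expr2 ler_peMl// ltW.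
(* Both norm bounds are proved squared and multiplied by [phs ^+ 2], which clears square roots and
   the denominator [phs]. *)
have le_of_sqr x y : 0 <= y -> phs ^+ 2 * x ^+ 2 <= phs ^+ 2 * y ^+ 2 -> x <= y.
  move=> y0; rewrite ler_pM2l ?exprn_gt0// => h.
  have [x0|x0] := leP x 0; first exact: le_trans y0.
  by rewrite -ler_sqr ?nnegrE ?(ltW x0).
have rate_ge0 (z : R) : 0 <= z ->
    0 <= K * (Lam / phs) * (tau / lam) * (lam * z).
  by move=> z0; rewrite !mulr_ge0 ?invr_ge0 ?(ltW K_gt0) ?(ltW phs_gt0)
    ?(ltW tau_gt0) ?(ltW lam_gt0).
have rate_sqr (z : R) :
    phs ^+ 2 * (K * (Lam / phs) * (tau / lam) * (lam * z)) ^+ 2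
      = K ^+ 2 * (Lam ^+ 2 * (tau ^+ 2 * z ^+ 2)).
  by field; rewrite !gt_eqF.
have l2_phs_ge0 : 0 <= phs ^+ 2 * l2norm (bt - b0) ^+ 2.
  by rewrite -exprMn sqr_ge0.
split.
- apply: le_trans G_le _; apply: (@le_trans _ _ (K * M)).
    by rewrite ler_wpM2r//; lra.
  rewrite le_eqVlt; apply/orP; left; apply/eqP.
  by rewrite /M; field; rewrite gt_eqF.
- apply: le_of_sqr; first by apply: rate_ge0; exact: ltW.
  rewrite rate_sqr.
  have -> : K ^+ 2 * (Lam ^+ 2 * (tau ^+ 2 * r ^+ 2)) = K ^+ 2 * M * r.
    by rewrite /M; ring.
  apply: (@le_trans _ _ (2 * (phs ^+ 2 * l2norm (bt - b0) ^+ 2) * r)); last first.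
    by rewrite ler_wpM2r ?(ltW r_gt0)//; exact: le_trans KM_le.
  have -> : 2 * (phs ^+ 2 * l2norm (bt - b0) ^+ 2) * r
      = phs ^+ 2 * ((2 * r) * l2norm (bt - b0) ^+ 2) by ring.
  rewrite ler_wpM2l ?sqr_ge0//.
  apply: le_trans (l1norm_sqr_le sU) _; rewrite ler_wpM2r ?sqr_ge0//.
  by rewrite -natrM ler_nat.
- apply: le_of_sqr; first by apply: rate_ge0; exact: sqrtr_ge0.
  rewrite rate_sqr (sqr_sqrtr (ltW r_gt0)) -/M; lra.
(* Times [tau ^+ 2], the claim is [card_le] with [m] unfolded, whose square supplies the fourth
   power of [ph]. *)
rewrite -(ler_pM2r (exprn_gt0 2 tau_gt0)); apply: le_trans card_le _.
rewrite le_eqVlt; apply/orP; left; apply/eqP.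
by rewrite /m; field; rewrite !gt_eqF.
Qed.
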